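(* Let $\mathcal{H}$ be a real Hilbert space and let $f:\mathcal{H}\to\mathbb{R}\cup\{+\infty\}$ be a proper, convex, lower semicontinuous function with $S:=\operatorname{argmin}_{\mathcal{H}} f\neq\emptyset$. Let $\alpha>1$, let $(s_k)_{k\ge0}$ be defined by $s_0:=0$ and $$s_{k+1}:=\frac{\alpha-1+\sqrt{(\alpha-1)^2+4s_k^2}}{2}\quad\forall k\ge0$$ (so that $s_{k+1}^2-(\alpha-1)s_{k+1}=s_k^2$), let $y_0,x_0\in\mathcal{H}$ be arbitrary, and let $(x_k)_{k\ge0}$ be the sequence generated by $$(\forall k\ge0)\quad\begin{cases}y_{k+1}:=\operatorname{prox}_{\frac{s_{k+1}}{\alpha-1}f}(y_k)\\ x_{k+1}:=\left(1-\frac{\alpha-1}{s_{k+1}}\right)x_k+\frac{\alpha-1}{s_{k+1}}y_{k+1}.\end{cases}$$ Then the following statements are true: (i) $f(x_k)-\inf_{\mathcal{H}}f=\mathcal{O}\left(\frac{1}{\sum_{i=0}^k s_i}\right)=\mathcal{O}\left(\frac1{s_k^2}\right)=\mathcal{O}\left(\frac1{(k+1)^2}\right)$ as $k\to+\infty$; (ii) $(x_k)_{k\ge0}$ converges weakly as $k\to+\infty$, and its limit belongs to $S$.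
   Context: For $\mu>0$, $\operatorname{prox}_{\mu f}(u)$ denotes the unique minimizer of $v\mapsto f(v)+\frac1{2\mu}\|v-u\|^2$. *)

(* Defs.v *)
From mathcomp Require Import all_boot all_order all_algebra sesquilinear.
From mathcomp Require Import all_classical all_reals all_analysis.
Export numFieldNormedType.Exports.

Set Implicit Arguments.
Unset Strict Implicit.
Unset Printing Implicit Defensive.
Import Order.TTheory GRing.Theory Num.Theory.
Local Open Scope classical_set_scope.
Local Open Scope ring_scope.

(* A real Hilbert space is a complete normed space whose norm is induced by an
   inner product; [{dot H for idfun}] is the type of symmetric positive definite
   bilinear forms on H. *)
Definition induces_norm (R : realType) (H : normedModType R)
  (dot : {dot H for idfun}) : Prop := forall u : H, dot u u = `|u| ^+ 2.

Definition weakly_cvg (R : realType) (H : normedModType R)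
    (dot : {dot H for idfun}) (x : nat -> H) (l : H) : Prop :=
  forall z : H, (dot (x k) z : R) @[k --> \oo] --> (dot l z : R).

Section extended_real_functions.
Context {R : realType} {H : normedModType R}.
Implicit Types f : H -> \bar R.
Local Open Scope ereal_scope.

(* The value -oo is excluded: f takes values in R `|` {+oo}. *)
Definition proper_fun f : Prop :=
  (forall u, f u != -oo) /\ exists u, f u != +oo.

(* With 0 < t < 1 and f > -oo, no indeterminate sum or product occurs. *)
Definition econvex f : Prop :=
  forall (u v : H) (t : R), (0 < t < 1)%R ->
    f (t *: u + (1 - t) *: v)%R <= t%:E * f u + (1 - t)%:E * f v.

Definition argmin f : set H := [set u | forall v, f u <= f v].

(* The unique minimizer of v |-> f v + (2 mu)^-1 |v - u|^2 (it exists for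
   mu > 0 and f proper, convex, lower semicontinuous on a Hilbert space); if
   there were no unique minimizer, the value would be the dummy 0. *)
Definition prox (mu : R) f (u : H) : H :=
  xget 0%R [set p | argmin (fun v => f v + ((2 * mu)^-1 * `|v - u| ^+ 2)%:E)
                    = [set p]].

End extended_real_functions.

Definition bigO_at_oo (R : realType) (a : nat -> R) : set (nat -> R) :=
  [set g | (g : nat -> R^o) =O_\oo (a : nat -> R^o)].

(* Main.v *)
Require Import Defs.
From mathcomp Require Import all_boot all_order all_algebra sesquilinear.
From mathcomp Require Import all_classical all_reals all_analysis.
From mathcomp Require Import ring lra.

Set Implicit Arguments.
Unset Strict Implicit.
Unset Printing Implicit Defensive.
Import Order.TTheory GRing.Theory Num.Theory.
Import numFieldNormedType.Exports.
Local Open Scope classical_set_scope.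
Local Open Scope ring_scope.

(** Put [c = alpha - 1]. The recursion for [s] says
    [s k.+1 ^+ 2 = s k ^+ 2 + c * s k.+1], so that
    [s k ^+ 2 = c * (s 1 + ... + s k)] and multiplying the recursion for [x] by
    [s k.+1 ^+ 2] exhibits [x k] as the average of the proximal iterates
    [y 1, ..., y k] with weights proportional to [s 1, ..., s k]: the scheme is
    the proximal point algorithm with step sizes [s k / c], followed by ergodic
    averaging.

    Rate. For a minimizer [u], the proximal inequality ([argmin_prox_le]) gives
    [2 * s k.+1 * (f (y k.+1) - f u)
     <= c * (|y k - u| ^+ 2 - |y k.+1 - u| ^+ 2)].
    Combined with convexity of [f] along the averages, it shows that
    [2 * s k ^+ 2 * (f (x k) - f u) + c ^+ 2 * |y k - u| ^+ 2] does not increase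
    ([average_energy]). Since [s k] lies between [c / 2 * k] and [c * k]
    ([step_linear]), the three rates are comparable.

    Weak convergence. The distances from [y k] to any minimizer decrease, so
    [dot (y k) (v - w)] converges for all minimizers [v] and [w], and so does its
    weighted mean [dot (x k) (v - w)] ([cvg_weighted_mean]). The sequence [x] is
    bounded, and [f (x k)] tends to the minimum, so every weak cluster point of
    [x] is a minimizer. As in Opial's lemma, two cluster points [v] and [w] then
    satisfy [dot v (v - w) = dot w (v - w)], that is [v = w]
    ([weakly_cvg_tail_hull]).

    Completeness of [H] enters through a single fact: a decreasing sequence of
    nonempty closed bounded convex sets has a common point
    ([closed_bounded_midconvex_nested]). Applied to sublevel sets, it yields the
    proximal points; applied to convex hulls of tails, it yields the weak cluster
    points. *)

(** * Inner product identities *)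

Section InnerProduct.
Context {R : realType} {H : normedModType R} (dot : {dot H for idfun}).
Hypothesis Hdot : induces_norm dot.

Lemma dotC u v : dot u v = dot v u.
Proof. by rewrite hermC expr0 mul1r. Qed.

Lemma dotDl u v w : dot (u + v) w = dot u w + dot v w.
Proof. exact: linearDl. Qed.

Lemma dotBl u v w : dot (u - v) w = dot u w - dot v w.
Proof. exact: linearBl. Qed.

Lemma dotDr u v w : dot u (v + w) = dot u v + dot u w.
Proof. exact: linearDr. Qed.

Lemma dotNr u v : dot u (- v) = - dot u v.
Proof. exact: linearNr. Qed.

Lemma dotZl a u v : dot (a *: u) v = a * dot u v.
Proof. exact: linearZl_LR. Qed.

Lemma sqr_normD u v : `|u + v| ^+ 2 = `|u| ^+ 2 + 2 * dot u v + `|v| ^+ 2.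
Proof. by rewrite -!Hdot dotDl !dotDr (dotC v u); ring. Qed.

Lemma sqr_normB u v : `|u - v| ^+ 2 = `|u| ^+ 2 - 2 * dot u v + `|v| ^+ 2.
Proof. by rewrite sqr_normD normrN dotNr mulrN. Qed.

Lemma sqr_norm_midpoint (u v : H) :
  `|2^-1 *: (u + v)| ^+ 2
  = (`|u| ^+ 2 + `|v| ^+ 2) / 2 - `|u - v| ^+ 2 / 4.
Proof.
rewrite normrZ exprMn sqr_normD sqr_normB ger0_norm ?invr_ge0//.
by field.
Qed.

Lemma dot_polarization u v : dot u v = (`|u + v| ^+ 2 - `|u - v| ^+ 2) / 4.
Proof. by rewrite sqr_normD sqr_normB; field. Qed.

Lemma continuous_sqr_normB (w : H) : continuous (fun u : H => `|u - w| ^+ 2 : R).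
Proof.
move=> u; apply: (@continuous_comp _ _ _ (fun u : H => `|u - w| : R)
  (fun r : R => r ^+ 2)); last exact: exprn_continuous.
apply: continuous_comp; last exact: norm_continuous.
by apply: cvgB; [exact: cvg_id | exact: cvg_cst].
Qed.

Lemma continuous_dot (z : H) : continuous (fun u : H => dot u z : R).
Proof.
move=> u.
rewrite (_ : (fun u : H => dot u z : R) =
  (fun u : H => (`|u - (- z)| ^+ 2 - `|u - z| ^+ 2) * 4^-1 : R)); last first.
  by apply/funext => v; rewrite dot_polarization opprK.
by apply: cvgMl; apply: cvgB; exact: continuous_sqr_normB.
Qed.

End InnerProduct.

(** * Intersections of closed bounded convex sets *)

(** For closed sets this is convexity; the parallelogram identity only ever
    produces midpoints. *)
Definition midconvex {R : realType} {H : lmodType R} (C : set H) :=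
  forall u v, C u -> C v -> C (2^-1 *: (u + v)).

Section Nested.
Context {R : realType} {H : completeNormedModType R} (dot : {dot H for idfun}).
Hypothesis Hdot : induces_norm dot.

(** Points [u n] of [C n] of almost minimal norm form a Cauchy sequence: the
    midpoint of [u m] and [u n] stays in [C m], so its norm is not much smaller
    than theirs, and the parallelogram identity bounds [u m - u n]. *)
Lemma closed_bounded_midconvex_nested (C : nat -> set H) (M : R) :
    (forall n, closed (C n)) -> (forall n, midconvex (C n)) ->
    (forall n, C n !=set0) -> (forall m n, (m <= n)%N -> C n `<=` C m) ->
    (forall u, C 0%N u -> `|u| <= M) ->
  exists u, forall n, C n u.
Proof.
move=> Ccl Cmid Cn0 Cdec CM.
pose E n : set R := [set `|u| ^+ 2 | u in C n].
have E_inf n : has_inf (E n).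
  split; first by have [u Cu] := Cn0 n; exists (`|u| ^+ 2), u.
  by exists 0 => _ [u _ <-]; exact: sqr_ge0.
pose D n := inf (E n).
have D_le n u : C n u -> D n <= `|u| ^+ 2.
  by move=> Cu; apply: ge_inf; [exact: (E_inf n).2 | exists u].
have /choice[u uP] : forall n, exists v,
    C n v /\ `|v| ^+ 2 <= D n + n.+1%:R^-1.
  move=> n; have n0 : 0 < n.+1%:R^-1 :> R by [].
  have [_ [v Cv <-] vlt] := inf_adherent n0 (E_inf n).
  by exists v; split => //; exact: ltW.
have D_incr m n : (m <= n)%N -> D m <= D n.
  move=> mn; apply: lb_le_inf; first exact: (E_inf n).1.
  by move=> _ [v Cv <-]; apply: D_le; exact: (Cdec _ _ mn).
have D_sup : has_sup (range D).
  split; first by exists (D 0%N), 0%N.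
  exists (M ^+ 2) => _ [n _ <-].
  have [v Cv] := Cn0 n; apply: (le_trans (D_le _ _ Cv)).
  have vM : `|v| <= M by apply: CM; exact: (Cdec 0%N n).
  by rewrite ler_sqr ?nnegrE// (le_trans _ vM).
(* The minimal squared norms increase with [n] and are bounded by [M ^+ 2]. *)
have [d D_d d_adh] : exists2 d, forall n, D n <= d &
    forall e, 0 < e -> exists n, d - e < D n.
  exists (sup (range D)) => [n|e e0].
    by apply: ub_le_sup; [exact: D_sup.2 | exists n].
  by have [_ [n _ <-] ltD] := sup_adherent e0 D_sup; exists n.
have u_near m n : (m <= n)%N ->
    `|u m - u n| ^+ 2 <= 4 * (d - D m) + 4 * m.+1%:R^-1.
  move=> mn; have [Cm um] := uP m; have [Cn un] := uP n.
  have := D_le _ _ (Cmid m _ _ Cm (Cdec _ _ mn _ Cn)).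
  rewrite (sqr_norm_midpoint Hdot).
  have nm : n.+1%:R^-1 <= m.+1%:R^-1 :> R by rewrite lef_pV2 ?posrE// ler_nat.
  move: um un nm; move: (`|u m| ^+ 2) (`|u n| ^+ 2) (`|u m - u n| ^+ 2).
  move: (D_d m) (D_d n); move: (n.+1%:R^-1) (m.+1%:R^-1) (D m) (D n) => *; lra.
have /cauchy_cvgP/cvg_ex[l ul] : cauchy (u @ \oo).
  apply: cauchy_exP => e e0.
  have e2 : 0 < e ^+ 2 / 8 by rewrite divr_gt0// exprn_gt0.
  have [N1 N1P] := d_adh _ e2.
  have [N2 _ N2P] := near_infty_natSinv_lt (PosNum e2).
  pose N := maxn N1 N2; exists (u N).
  exists N => // n /= Nn; rewrite -ball_normE /=.
  rewrite -ltr_sqr ?nnegrE ?(ltW e0)//.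
  apply: (le_lt_trans (u_near _ _ Nn)).
  have := N2P N (leq_maxr _ _); have := D_incr _ _ (leq_maxl N1 N2).
  move: N1P; rewrite /=; move: (N.+1%:R^-1) (e ^+ 2) (D N) (D N1) => *; lra.
exists l => n; apply: (closed_cvg (C n) (Ccl n) _ l ul).
exists n => // k /= nk; exact: (Cdec _ _ nk _ (uP k).1).
Qed.
End Nested.

(** * Proximal points of convex lower semicontinuous functions *)

Section Prox.
Context {R : realType} {H : completeNormedModType R} (dot : {dot H for idfun}).
Hypothesis Hdot : induces_norm dot.
Variable f : H -> \bar R.
Hypotheses (f_proper : proper_fun f) (f_convex : econvex f)
  (f_lsc : lower_semicontinuous f).

(** A variable level [g] is allowed because [f v + a |v - w| ^+ 2 <= r] is the
    condition [f v <= r - a |v - w| ^+ 2] on [f] alone. *)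
Lemma closed_sublevel (g : H -> R) :
  continuous g -> closed [set v | (f v <= (g v)%:E)%E].
Proof.
move=> g_cont; rewrite -openC openE => v /= /negP; rewrite -ltNge => gf.
have [b gb bf] : exists2 b : R, g v < b & (b%:E < f v)%E.
  case: (f v) gf => [r| |]; rewrite ?lte_fin => gr //.
    by exists ((g v + r) / 2); rewrite ?lte_fin; lra.
  by exists (g v + 1); [rewrite ltrDl | exact: ltry].
have [V Vv Vf] := f_lsc bf.
have gW : \forall w \near v, g w < b.
  have /cvgrPdist_lt /(_ (b - g v)) := g_cont v.
  rewrite subr_gt0 => /(_ gb); apply: filterS => w.
  by rewrite ltr_norml => /andP[]; lra.
apply: filterS (filterI Vv gW) => w [/= /Vf bfw gwb] /=.
by apply/negP; rewrite -ltNge; apply: lt_trans bfw; rewrite lte_fin.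
Qed.

Lemma midconvex_sublevel (g : H -> R) :
    (forall u v, (g u + g v) / 2 <= g (2^-1 *: (u + v))) ->
  midconvex [set v | (f v <= (g v)%:E)%E].
Proof.
move=> g_mid u v /= fu fv.
have half : (0 < 2^-1 :> R) && (2^-1 < 1 :> R) by lra.
rewrite scalerDr; have -> : 2^-1 *: v = (1 - 2^-1) *: v by congr (_ *: _); lra.
apply: (le_trans (f_convex u v half)).
have -> : 1 - 2^-1 = 2^-1 :> R by lra.
apply: (@le_trans _ _ (2^-1%:E * (g u)%:E + 2^-1%:E * (g v)%:E)%E).
  by apply: leeD; apply: lee_wpmul2l => //; rewrite lee_fin; lra.
rewrite -[2^-1 *: u + _]scalerDr -!EFinM -EFinD lee_fin.
by apply: (le_trans _ (g_mid u v)); lra.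
Qed.

Lemma argmin_fin_num v : argmin f v -> f v \is a fin_num.
Proof.
have [f_ninf [w fw]] := f_proper => /(_ w) v_min.
rewrite fin_numE f_ninf /=; apply: contraTneq v_min => ->.
by rewrite leye_eq.
Qed.

Lemma fine_convex v w (t : R) : 0 < t < 1 ->
    f v \is a fin_num -> f w \is a fin_num ->
  f ((1 - t) *: v + t *: w) \is a fin_num /\
  fine (f ((1 - t) *: v + t *: w)) <= (1 - t) * fine (f v) + t * fine (f w).
Proof.
move=> t01 fv fw.
have t01' : 0 < 1 - t < 1 by lra.
have := f_convex v w t01'; rewrite subKr.
have := f_proper.1 ((1 - t) *: v + t *: w).
rewrite -(fineK fv) -(fineK fw) -!EFinM -EFinD.
by case: (f (_ + _)) => [r| |]//= _; rewrite lee_fin.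
Qed.

Lemma argmin_prox_fin (mu : R) w p :
  argmin (fun v => f v + ((2 * mu)^-1 * `|v - w| ^+ 2)%:E)%E p ->
  f p \is a fin_num.
Proof.
have [f_ninf [v fv]] := f_proper => /(_ v) /=.
rewrite fin_numE f_ninf /=; apply: contraTneq => ->.
case: (f v) fv (f_ninf v) => [r| |]//= _ _.
Qed.

(** Comparing [p] with the points [p + t (v - p)] and letting [t] tend to [0]
    turns minimality into the variational inequality
    [f p - f v <= <p - w, v - p> / mu], whose right-hand side is expanded. *)
Lemma argmin_prox_le (mu : R) w p v : 0 < mu ->
    argmin (fun v => f v + ((2 * mu)^-1 * `|v - w| ^+ 2)%:E)%E p ->
    f v \is a fin_num ->
  2 * mu * (fine (f p) - fine (f v))
  <= `|v - w| ^+ 2 - `|v - p| ^+ 2 - `|p - w| ^+ 2.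
Proof.
move=> mu0 p_min fv; have fp := argmin_prox_fin p_min.
have vw : v - w = (p - w) + (v - p) by rewrite [RHS]addrC subrKA.
rewrite {1}vw (sqr_normD Hdot (p - w)).
set d := dot _ _; set a := `|v - p| ^+ 2; set b := `|p - w| ^+ 2.
have a0 : 0 <= a := sqr_ge0 _.
have step (t : R) : 0 < t < 1 ->
    2 * mu * (fine (f p) - fine (f v)) <= 2 * d + t * a.
  move=> t01; have := p_min (t *: v + (1 - t) *: p) => /=.
  have -> : t *: v + (1 - t) *: p - w = (p - w) + t *: (v - p).
    by rewrite scalerBl scale1r scalerBr [_ *: v + _]addrCA addrAC.
  rewrite (sqr_normD Hdot (p - w)) normrZ exprMn (dotC dot (p - w)) dotZl (dotC dot _ (p - w)).
  rewrite -/d -/a -/b.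
  have := f_convex v p t01.
  move: (f (_ + _)) => F; rewrite -(fineK fv) -(fineK fp).
  move: (fine (f v)) (fine (f p)) => fv' fp' F_le min_le.
  move: (le_trans min_le (leeD F_le (lexx _))).
  rewrite -!EFinM -!EFinD lee_fin.
  have t0 : 0 < t by case/andP: t01.
  rewrite (gtr0_norm t0) => h.
  have {}h : (2 * mu)^-1 * b + t * (fp' - fv')
      <= (2 * mu)^-1 * (b + 2 * (t * d) + t ^+ 2 * a) by lra.
  rewrite mulrDr in h.
  have {}h : t * (2 * mu * (fp' - fv')) <= t * (2 * d + t * a).
    rewrite -(ler_pM2l (_ : 0 < (2 * mu)^-1)) ?invr_gt0 ?mulr_gt0//.
    rewrite [leLHS](_ : _ = t * (fp' - fv')); last by field; rewrite gt_eqF.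
    by move: h; rewrite mulrDr !expr2; move: (_^-1) => k; lra.
  by rewrite ler_pM2l in h.
rewrite (_ : b + _ + _ - _ - _ = 2 * d); last by rewrite /b /a; ring.
rewrite leNgt; apply/negP => lt2d.
move: (2 * mu * _) lt2d step => L lt2d step.
(* Small enough that [t * a < L - 2 * d], with a denominator that is positive
   even when [a = 0]. *)
pose t := (L - 2 * d) / (2 * (L - 2 * d + a)).
have := step t; have : t * (2 * (L - 2 * d + a)) = L - 2 * d.
  by rewrite /t divfK// gt_eqF//; lra.
nra.
Qed.

(** Adding the inequalities [argmin_prox_le] for the pairs [p, q] and [q, p]
    leaves [2 * |q - p| ^+ 2 <= 0]. *)
Lemma argmin_prox_unique (mu : R) w p q : 0 < mu ->
    argmin (fun v => f v + ((2 * mu)^-1 * `|v - w| ^+ 2)%:E)%E p ->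
    argmin (fun v => f v + ((2 * mu)^-1 * `|v - w| ^+ 2)%:E)%E q ->
  q = p.
Proof.
move=> mu0 p_min q_min.
have := argmin_prox_le mu0 p_min (argmin_prox_fin q_min).
have := argmin_prox_le mu0 q_min (argmin_prox_fin p_min).
rewrite [`|p - q|]distrC => h1 h2.
have : `|q - p| ^+ 2 <= 0 by lra.
by rewrite real_exprn_even_le0// normr_eq0 subr_eq0 => /eqP.
Qed.

(** The sets where the penalized function is within [n.+1%:R^-1] of its infimum
    are closed and convex, and the penalty makes them bounded because [f] is
    bounded below; their common point is a minimizer. *)
Lemma argmin_prox_ex (mu : R) w (m : R) : 0 < mu -> (forall v, (m%:E <= f v)%E) ->
  exists p, argmin (fun v => f v + ((2 * mu)^-1 * `|v - w| ^+ 2)%:E)%E p.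
Proof.
move=> mu0 m_le; set a := (2 * mu)^-1.
have a0 : 0 < a by rewrite invr_gt0 mulr_gt0.
pose C r := [set v | (f v <= (r - a * `|v - w| ^+ 2)%:E)%E].
have Ccl r : closed (C r).
  apply: closed_sublevel => v; apply: cvgB; first exact: cvg_cst.
  by apply: cvgMr; exact: continuous_sqr_normB.
have Cmid r : midconvex (C r).
  apply: midconvex_sublevel => u v.
  have -> : 2^-1 *: (u + v) - w = 2^-1 *: ((u - w) + (v - w)).
    rewrite addrACA -opprD scalerBr; congr (_ - _).
    by rewrite -mulr2n -[w *+ 2]scaler_nat scalerA mulVf ?scale1r.
  rewrite (sqr_norm_midpoint Hdot).
  move: (`|u - w| ^+ 2) (`|v - w| ^+ 2) (sqr_ge0 `|(u - w) - (v - w)|) => *.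
  nra.
have C_le r v : C r v -> m + a * `|v - w| ^+ 2 <= r.
  by move=> /(le_trans (m_le v)); rewrite lee_fin; lra.
pose E := [set r | C r !=set0].
have E_inf : has_inf E.
  split.
    have [_ [v fv]] := f_proper.
    have vfin : f v \is a fin_num by rewrite fin_numE f_proper.1.
    exists (fine (f v) + a * `|v - w| ^+ 2), v.
    by rewrite /C /= addrK fineK.
  exists m => r [v /C_le]; apply: le_trans.
  by rewrite lerDl mulr_ge0 ?sqr_ge0// ltW.
pose r0 := inf E.
pose r n := r0 + n.+1%:R^-1.
have Cn0 n : C (r n) !=set0.
  have n0 : 0 < n.+1%:R^-1 :> R by [].
  have [s [v Cv] sr] := inf_adherent n0 E_inf.
  by exists v; apply: (le_trans Cv); rewrite lee_fin lerD2r ltW.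
have Cdec i n : (i <= n)%N -> C (r n) `<=` C (r i).
  move=> le_in v; move=> /le_trans; apply.
  by rewrite lee_fin lerD2r lerD2l lef_pV2 ?posrE// ler_nat.
have Cbd v : C (r 0%N) v -> `|v| <= `|w| + (1 + (r 0%N - m) / a).
  move=> /C_le; rewrite addrC -lerBrDr mulrC -ler_pdivlMr// => h.
  rewrite -[v](subrK w) addrC; apply: (le_trans (ler_normD _ _)).
  rewrite lerD2l.
  (* [r <= 1 + r ^+ 2] turns the quadratic bound into a linear one. *)
  apply: le_trans (_ : 1 + `|v - w| ^+ 2 <= _).
    by have := sqr_ge0 (`|v - w| - 1); nra.
  by rewrite lerD2l.
have [p Cp] := closed_bounded_midconvex_nested Hdot
  (fun n => Ccl (r n)) (fun n => Cmid (r n)) Cn0 Cdec Cbd.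
exists p => v /=.
have [->|fv] := eqVneq (f v) +oo%E; first by rewrite leey.
have vfin : f v \is a fin_num by rewrite fin_numE f_proper.1.
have r0_le : r0 <= fine (f v) + a * `|v - w| ^+ 2.
  by apply: ge_inf; [exact: E_inf.2 | exists v; rewrite /C /= addrK fineK].
have pfin : f p \is a fin_num.
  rewrite fin_numE f_proper.1 /=; apply: contraTneq (Cp 0%N) => fp.
  by rewrite /C /= fp leye_eq.
have {}Cp n : fine (f p) + a * `|p - w| ^+ 2 <= r0 + n.+1%:R^-1.
  by have := Cp n; rewrite /C /= -{1}(fineK pfin) lee_fin -lerBrDr.
rewrite -(fineK vfin) -(fineK pfin) -!EFinD lee_fin.
apply: (le_trans _ r0_le); apply/ler_addgt0Pr => e e0.
have [N _ NP] := near_infty_natSinv_lt (PosNum e0).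
apply: (le_trans (Cp N)); rewrite lerD2l; apply: ltW; exact: NP (leqnn N).
Qed.

Lemma proxP (mu : R) w (m : R) : 0 < mu -> (forall v, (m%:E <= f v)%E) ->
  argmin (fun v => f v + ((2 * mu)^-1 * `|v - w| ^+ 2)%:E)%E (prox mu f w).
Proof.
move=> mu0 m_le; have [p p_min] := argmin_prox_ex w mu0 m_le.
have argminE : argmin (fun v => f v + ((2 * mu)^-1 * `|v - w| ^+ 2)%:E)%E = [set p].
  apply/seteqP; split => q; last by move=> /= ->.
  exact: argmin_prox_unique.
have := @xgetPex _ 0 [set p | argmin (fun v => f v + ((2 * mu)^-1 * `|v - w| ^+ 2)%:E)%E = [set p]].
by rewrite -/(prox mu f w) => -> //=; exists p.
Qed.
End Prox.

(** * Weak cluster points and Opial's lemma *)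

Section WeakLimits.
Context {R : realType} {H : completeNormedModType R} (dot : {dot H for idfun}).
Hypothesis Hdot : induces_norm dot.

(** The intersection over [n] of the closed convex hulls of
    [{x k | n <= k, P k}]. It contains the weak cluster points of [x] along the
    indices satisfying [P], and can replace them: a closed convex condition that
    holds for almost all these [x k] holds on [tail_hull x P]. *)
Definition tail_hull (x : nat -> H) (P : nat -> Prop) : set H :=
  [set v | forall C : set H, closed C -> midconvex C ->
    (\forall k \near \oo, P k -> C (x k)) -> C v].

Lemma tail_hull_sub x (P : nat -> Prop) :
  tail_hull x P `<=` tail_hull x (fun=> True).
Proof.
move=> v vP C Ccl Cmid Cx; apply: vP => //.
by apply: filterS Cx => k /(_ I).
Qed.

(** Weak sequential compactness of bounded sequences, in the form used here: the
    closed convex hulls of the tails are nested and bounded. *)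
Lemma tail_hull_neq0 x P (M : R) :
    (forall k, `|x k| <= M) -> (forall n, exists2 k, (n <= k)%N & P k) ->
  tail_hull x P !=set0.
Proof.
move=> xM Pfreq.
pose hull (T : set H) : set H :=
  [set v | forall C, closed C -> midconvex C -> T `<=` C -> C v].
have hull_sub T C : closed C -> midconvex C -> T `<=` C -> hull T `<=` C.
  by move=> *; move=> v; apply.
pose T n : set H := [set x k | k in [set k | (n <= k)%N /\ P k]].
have hull_cl (A : set H) : closed (hull A).
  move=> v v_cl C Ccl Cmid AC; apply: (Ccl) => B /v_cl [w [Aw Bw]].
  by exists w; split => //; exact: Aw.
have hull_mid (A : set H) : midconvex (hull A).
  by move=> u v Au Av C Ccl Cmid AC; apply: (Cmid); [exact: Au | exact: Av].
have [||n|m n mn|v|v vT] := @closed_bounded_midconvex_nested _ _ dot Hdot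
    (fun n => hull (T n)) M.
- by move=> n; exact: hull_cl.
- by move=> n; exact: hull_mid.
- have [k nk Pk] := Pfreq n; exists (x k) => C _ _; apply.
  by exists k.
- move=> v vT C Ccl Cmid TC; apply: vT => // _ [k [nk Pk] <-]; apply: TC.
  by exists k => //; split => //; exact: leq_trans nk.
- apply: (hull_sub (T 0%N) [set v | `|v| <= M]).
  + rewrite (_ : mkset _ = (fun v : H => `|v| : R) @^-1` [set r | r <= M])//.
    apply: closed_comp => [? _|]; [exact: norm_continuous|exact: closed_le].
  + move=> a b /= aM bM; rewrite normrZ ger0_norm ?invr_ge0//.
    by have := ler_normD a b; lra.
  + by move=> _ [k _ <-] /=.
- exists v => C Ccl Cmid [N _ NC]; apply: (vT N) => // _ [k [Nk Pk] <-].
  exact: NC.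
Qed.

Lemma tail_hull_dot_ge x P v e (a : R) :
  tail_hull x P v -> (\forall k \near \oo, P k -> a <= dot (x k) e) ->
  a <= dot v e.
Proof.
move=> vP xP; apply: (vP [set w | a <= dot w e]) => //.
  rewrite (_ : mkset _ = (fun w : H => dot w e : R) @^-1` [set r | a <= r])//.
  apply: closed_comp => [? _|]; [exact: continuous_dot|exact: closed_ge].
by move=> u w /=; rewrite dotZl dotDl; lra.
Qed.

Lemma tail_hull_dot_eq x P v e (a : R) :
  tail_hull x P v -> (dot (x k) e : R) @[k --> \oo] --> a -> dot v e = a.
Proof.
move=> /tail_hull_sub vP /cvgrPdist_le xa.
apply/eqP; rewrite eq_le; apply/andP; split.
- rewrite -lerN2 -(dotNr dot); apply/ler_addgt0Pr => eps eps0.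
  rewrite -lerBlDr; apply: (tail_hull_dot_ge vP).
  apply: filterS (xa _ eps0) => k + _.
  by rewrite ler_norml dotNr; lra.
- apply/ler_addgt0Pr => eps eps0; rewrite -lerBlDr.
  apply: (tail_hull_dot_ge vP); apply: filterS (xa _ eps0) => k + _.
  by rewrite ler_norml; lra.
Qed.

(** Opial's argument. For points [v] and [l] of tail hulls, [dot v (v - l)] and
    [dot l (v - l)] both equal the limit of [dot (x k) (v - l)], whence [v = l]. If [dot (x k) z] exceeded
    [dot l z + e] infinitely often, a point of the tail hull along these indices
    would inherit the inequality, and yet be equal to [l]. *)
Lemma weakly_cvg_tail_hull x (S : set H) (M : R) :
    (forall k, `|x k| <= M) -> tail_hull x (fun=> True) `<=` S ->
    (forall u v, S u -> S v -> cvgn (fun k => dot (x k) (u - v) : R)) ->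
  exists2 l, S l & weakly_cvg dot x l.
Proof.
move=> xM hullS xcvg.
have [|l lP] := @tail_hull_neq0 x (fun=> True) _ xM; first by move=> n; exists n.
have Sl := hullS _ lP.
have hull_l P v : tail_hull x P v -> v = l.
  move=> vP; have Sv := hullS _ (tail_hull_sub vP).
  have vl := xcvg _ _ Sv Sl.
  have := tail_hull_dot_eq lP vl; rewrite -(tail_hull_dot_eq vP vl) => eq_lv.
  by apply/eqP; rewrite -subr_eq0 -normr_eq0 -sqrf_eq0 -Hdot dotBl eq_lv subrr.
exists l => //.
have half z e : 0 < e -> \forall k \near \oo, dot (x k) z < dot l z + e.
  move=> e0; apply: contrapT => nP.
  have [|v vP] := @tail_hull_neq0 x (fun k => dot l z + e <= dot (x k) z) _ xM.
    move=> n; apply: contrapT => nk; apply: nP; exists n => // k /= le_nk.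
    by rewrite ltNge; apply/negP => ?; apply: nk; exists k.
  suff : dot l z + e <= dot l z by rewrite gerDl leNgt e0.
  rewrite -{2}(hull_l _ _ vP); apply: (tail_hull_dot_ge vP).
  exact: nearW.
move=> z; apply/cvgrPdist_lt => e e0.
have := half z _ e0; have := half (- z) _ e0.
apply: filterS2 => k; rewrite !dotNr ltr_norml; lra.
Qed.
End WeakLimits.

(** * Comparison of rates and weighted means *)

Lemma bigO_at_oo_subset {R : realType} (a b : nat -> R) (A : R) : 0 < A ->
  (\forall k \near \oo, `|a k| <= A * `|b k|) -> bigO_at_oo a `<=` bigO_at_oo b.
Proof.
move=> A0 ab g /eqO_exP[K K0 gK]; apply/eqO_exP; exists (K * A).
  exact: mulr_gt0.
apply: filterS2 ab gK => k abk gk; apply: (le_trans gk).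
by rewrite -mulrA ler_wpM2l// ltW.
Qed.

(** The recursion says that [a k] is, up to a vanishing term carried by [w 0],
    the mean of [b 1, ..., b k] with weights [w i.+1 - w i]. Past an index [N]
    where [b] is [e / 2]-close to [l], the total error [w k * |l - a k|] grows by
    at most [e / 2] times the added weight, and the error made before [N] is
    absorbed as [w k] tends to infinity. *)
Lemma cvg_weighted_mean {R : realType} (w a b : nat -> R) (l : R) :
    (forall k, 0 <= w k <= w k.+1) -> w @ \oo --> +oo ->
    (forall k, w k.+1 * a k.+1 = w k * a k + (w k.+1 - w k) * b k.+1) ->
  b @ \oo --> l -> a @ \oo --> l.
Proof.
move=> w_incr /cvgryPge w_oo a_rec /cvgrPdist_le b_l.
apply/cvgrPdist_le => e e0.
have e2 : 0 < e / 2 by rewrite divr_gt0.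
have [N _ bN] := b_l _ e2.
pose K := w N * `|l - a N|.
have K0 : 0 <= K by rewrite mulr_ge0//; case/andP: (w_incr N).
have w_a k : (N <= k)%N -> w k * `|l - a k| <= K + e / 2 * (w k - w N).
  move=> /subnK <-; elim: (k - N)%N => [|j IH]; first by rewrite subrr mulr0 addr0.
  rewrite addSn; move: (_ + N)%N (leq_addl j N) IH => i Ni IH.
  have /andP[wi0 wi] := w_incr i.
  have -> : w i.+1 * `|l - a i.+1|
      = `|w i * (l - a i) + (w i.+1 - w i) * (l - b i.+1)|.
    rewrite -[in LHS](ger0_norm (le_trans wi0 wi)) -normrM; congr (`|_|).
    by rewrite mulrBr a_rec; ring.
  apply: (le_trans (ler_normD _ _)).
  rewrite !normrM (ger0_norm wi0) (ger0_norm (_ : 0 <= w i.+1 - w i)) ?subr_ge0//.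
  have := bN i.+1 (leqW Ni); rewrite -subr_ge0 => h.
  have := mulr_ge0 (_ : 0 <= w i.+1 - w i) h; rewrite subr_ge0 => /(_ wi).
  by lra.
have [N' _ wN'] := w_oo (2 * K / e + 1).
exists (maxn N N') => // k /=; rewrite geq_max => /andP[/w_a wa /wN' wk].
have w0 : 0 < w k.
  have : 0 <= 2 * K / e by apply: divr_ge0 (ltW e0); apply: mulr_ge0.
  by lra.
rewrite -(ler_pM2l w0); apply: (le_trans wa).
have : K <= e / 2 * w k.
  have : 2 * K / e <= w k by lra.
  by rewrite ler_pdivrMr//; lra.
have : 0 <= e / 2 * w N by rewrite mulr_ge0 ?(ltW e2)//; case/andP: (w_incr N).
by lra.
Qed.

(** * Step sizes *)

Section StepSizes.
Context {R : realType} (c : R) (s : nat -> R).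
Hypotheses (c0 : 0 < c) (s0 : s 0%N = 0)
  (sS : forall k, s k.+1 = (c + Num.sqrt (c ^+ 2 + 4 * s k ^+ 2)) / 2).

Lemma step_ge0 k : 0 <= s k.
Proof.
case: k => [|k]; first by rewrite s0.
by rewrite sS divr_ge0// addr_ge0 ?sqrtr_ge0// ltW.
Qed.

Lemma sqr_stepS k : s k.+1 ^+ 2 = s k ^+ 2 + c * s k.+1.
Proof.
have : Num.sqrt (c ^+ 2 + 4 * s k ^+ 2) ^+ 2 = c ^+ 2 + 4 * s k ^+ 2.
  by rewrite sqr_sqrtr// addr_ge0 ?sqr_ge0// mulr_ge0// sqr_ge0.
have := sS k; move: (Num.sqrt _) => q -> q2.
by apply: (@mulfI _ 4) => //; move: q2; rewrite !expr2; lra.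
Qed.

Lemma step_incr k : s k + c / 2 <= s k.+1 <= s k + c.
Proof.
have S_ge : c / 2 <= s k.+1 by rewrite sS ler_pM2r ?invr_gt0// lerDl sqrtr_ge0.
have := step_ge0 k; have := sqr_stepS k.
move: (s k.+1) (s k) S_ge (c0) => S a S_ge c_gt0.
rewrite !expr2 => S2 a0; apply/andP; split; rewrite leNgt; apply/negP => lt_S.
- have : 0 <= (a - (S - c / 2)) * (a + (S - c / 2)) by apply: mulr_ge0; lra.
  by have := mulr_gt0 c0 c0; lra.
- have : 0 < (S - c - a) * S by apply: mulr_gt0; lra.
  by have : 0 <= a * (S - a) by [apply: mulr_ge0; lra]; lra.
Qed.

Lemma step_linear k : c / 2 * k%:R <= s k <= c * k%:R.
Proof.
elim: k => [|k IH]; first by rewrite s0 !mulr0 lexx.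
move: IH (step_incr k); rewrite -(natr1 k).
by move: (k%:R) => K; lra.
Qed.

Lemma sum_step k : c * \sum_(0 <= i < k.+1) s i = s k ^+ 2.
Proof.
elim: k => [|k IH]; first by rewrite big_nat1 s0 mulr0 expr0n.
by rewrite big_nat_recr//= mulrDr IH sqr_stepS.
Qed.

Lemma stepS_ge k : c <= s k.+1.
Proof.
rewrite -subr_ge0 -(pmulr_rge0 _ (_ : 0 < s k.+1)).
  by rewrite mulrBr mulrC -expr2 sqr_stepS mulrC addrK sqr_ge0.
move: c0 (step_incr k) (step_ge0 k); lra.
Qed.

Lemma stepS_gt0 k : 0 < s k.+1.
Proof. exact: lt_le_trans c0 (stepS_ge k). Qed.

Lemma sqr_step_cvgy : (s k ^+ 2) @[k --> \oo] --> +oo.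
Proof.
apply/cvgryPge => A; have [N _ NP] := nbhs_infty_ger ((`|A| + 1) / (c / 2)).
have c2 : 0 < c / 2 by rewrite divr_gt0.
exists N => // k /= /NP; rewrite ler_pdivrMr// mulrC.
have /andP[+ _] := step_linear k => /[swap] /le_trans h /h {h} => sk.
have A_ge0 : 0 <= `|A| by []; have := ler_norm A.
have : 0 <= (s k - (`|A| + 1)) * s k by apply: mulr_ge0; lra.
by move: sk; rewrite expr2 => *; nra.
Qed.

End StepSizes.

(** * Averaged proximal iterates *)

Section Averaging.
Context {R : realType} {H : completeNormedModType R} (dot : {dot H for idfun}).
Hypothesis Hdot : induces_norm dot.
Variable f : H -> \bar R.
Hypotheses (f_proper : proper_fun f) (f_convex : econvex f)
  (f_lsc : lower_semicontinuous f).
Variables (c : R) (s : nat -> R) (x y : nat -> H).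
Hypotheses (c0 : 0 < c) (s0 : s 0%N = 0)
  (sS : forall k, s k.+1 = (c + Num.sqrt (c ^+ 2 + 4 * s k ^+ 2)) / 2).
Hypotheses (yS : forall k, y k.+1 = prox (s k.+1 / c) f (y k))
  (xS : forall k, x k.+1 = (1 - c / s k.+1) *: x k + (c / s k.+1) *: y k.+1).
Variable u : H.
Hypothesis u_min : argmin f u.

Local Notation m := (fine (f u)).

Lemma ge_argmin v : (m%:E <= f v)%E.
Proof. by rewrite fineK ?(argmin_fin_num f_proper u_min). Qed.

Let s_gt0 k : 0 < s k.+1 := stepS_gt0 c0 s0 sS k.

Lemma prox_step k : argmin (fun v => f v
  + ((2 * (s k.+1 / c))^-1 * `|v - y k| ^+ 2)%:E)%E (y k.+1).
Proof.
rewrite yS; apply: (proxP Hdot f_proper f_convex f_lsc _ _ ge_argmin).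
exact: divr_gt0.
Qed.

Lemma prox_iterate_fin_num k : f (y k.+1) \is a fin_num.
Proof. exact: argmin_prox_fin (prox_step k). Qed.

Lemma prox_iterate_decrease k v : f v \is a fin_num ->
  2 * s k.+1 * (fine (f (y k.+1)) - fine (f v))
  <= c * (`|y k - v| ^+ 2 - `|y k.+1 - v| ^+ 2).
Proof.
move=> fv.
have := argmin_prox_le Hdot f_proper f_convex (divr_gt0 (s_gt0 k) c0)
  (prox_step k) fv.
rewrite !(distrC v) -(ler_pM2l c0).
rewrite [leLHS](_ : _ = 2 * s k.+1 * (fine (f (y k.+1)) - fine (f v))).
  have := mulr_ge0 (ltW c0) (sqr_ge0 `|y k.+1 - y k|).
  move: (`|_| ^+ 2) (`|_| ^+ 2) (`|_| ^+ 2) => *; lra.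
by field; rewrite gt_eqF.
Qed.

(** The decrease inequality at a minimizer [v], where its left-hand side is
    nonnegative: the proximal iterates are Fejer monotone. *)
Lemma prox_iterate_fejer v k : argmin f v -> `|y k.+1 - v| <= `|y k - v|.
Proof.
move=> v_min; have fv := argmin_fin_num f_proper v_min.
have := prox_iterate_decrease k fv.
have : fine (f v) <= fine (f (y k.+1)).
  by rewrite -lee_fin !fineK ?prox_iterate_fin_num.
rewrite -subr_ge0 => h; have : 0 <= 2 * s k.+1 by rewrite mulr_ge0// ltW.
move=> /mulr_ge0/(_ h) h' /(le_trans h').
by rewrite pmulr_rge0// subr_ge0 ler_sqr ?nnegrE.
Qed.

Lemma weight_itv k : 0 < c / s k.+1 <= 1.
Proof. by rewrite divr_gt0//= ler_pdivrMr// mul1r (stepS_ge c0 s0 sS). Qed.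

(** Convexity of [f], multiplied by [s k.+1 ^+ 2]. Since [s 1 = c] gives [x 0]
    the weight [0] in [x 1] and [s 0 = 0], the statement covers [k = 0] even when
    [f (x 0)] is infinite, with the default value of [fine]. *)
Lemma average_fin_num_and_le k : f (x k.+1) \is a fin_num /\
  s k.+1 ^+ 2 * (fine (f (x k.+1)) - m)
  <= s k ^+ 2 * (fine (f (x k)) - m) + c * s k.+1 * (fine (f (y k.+1)) - m).
Proof.
have sq i := sqr_stepS sS i.
elim: k => [|k [IH _]].
  have s1 : s 1%N = c.
    apply: (mulfI (lt0r_neq0 (s_gt0 0))).
    by rewrite -expr2 sq s0 expr0n add0r mulrC.
  have -> : x 1%N = y 1%N.
    by rewrite xS s1 divff ?gt_eqF// subrr scale0r scale1r add0r.
  split; first exact: prox_iterate_fin_num.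
  by rewrite sq s0 expr0n mul0r !add0r.
have t01 : 0 < c / s k.+2 < 1.
  rewrite divr_gt0//= ltr_pdivrMr// mul1r -(ltr_pM2r (s_gt0 k.+1)).
  by rewrite -expr2 sq ltrDr exprn_gt0.
have [] := fine_convex f_proper f_convex t01 IH (prox_iterate_fin_num k.+1).
rewrite -xS => x_fin x_le; split => //.
move: x_le; rewrite -(ler_pM2l (exprn_gt0 2 (s_gt0 k.+1))).
have e1 : s k.+2 ^+ 2 * (c / s k.+2) = c * s k.+2 by field; rewrite gt_eqF.
have e2 : s k.+2 ^+ 2 * (1 - c / s k.+2) = s k.+1 ^+ 2.
  by rewrite mulrBr mulr1 e1 sq addrK.
rewrite mulrDr (mulrA _ (1 - _)) e2 (mulrA _ (c / _)) e1 !mulrBr => x_le.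
have : s k.+2 ^+ 2 * m = s k.+1 ^+ 2 * m + c * s k.+2 * m by rewrite sq mulrDl.
move: (_ * m) (_ * m) (_ * m) x_le => *; lra.
Qed.

(** The energy that decreases along the iteration: the increase of
    [s k ^+ 2 * (f (x k) - m)] is paid for by the decrease of [|y k - u| ^+ 2]. *)
Lemma average_energy k :
  2 * s k ^+ 2 * (fine (f (x k)) - m) + c ^+ 2 * `|y k - u| ^+ 2
  <= c ^+ 2 * `|y 0%N - u| ^+ 2.
Proof.
elim: k => [|k IH]; first by rewrite s0; lra.
apply: le_trans IH; have := (average_fin_num_and_le k).2.
have fu := argmin_fin_num f_proper u_min.
have := prox_iterate_decrease k fu; rewrite -(ler_pM2l c0).
rewrite !expr2; move: (`|_|) (`|_|) => *; lra.
Qed.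

Lemma average_rate k :
  0 <= fine (f (x k.+1)) - m <= c ^+ 2 * `|y 0%N - u| ^+ 2 / 2 / s k.+1 ^+ 2.
Proof.
have x_fin := (average_fin_num_and_le k).1.
rewrite subr_ge0 -lee_fin !fineK// ?(argmin_fin_num f_proper u_min)// u_min /=.
rewrite ler_pdivlMr ?exprn_gt0// mulrC.
have := average_energy k.+1.
have := mulr_ge0 (sqr_ge0 c) (sqr_ge0 `|y k.+1 - u|).
rewrite -mulrA; move: (c ^+ 2 * `|y k.+1 - u| ^+ 2) (c ^+ 2 * `|y 0%N - u| ^+ 2).
by move: (s k.+1 ^+ 2 * _) => *; lra.
Qed.

Lemma average_bounded : exists M, forall k, `|x k| <= M.
Proof.
pose B := `|y 0%N - u| + `|u|.
have yB k : `|y k| <= B.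
  rewrite -[y k](subrK u); apply: (le_trans (ler_normD _ _)); rewrite lerD2r.
  elim: k => [|k IH] //; apply: le_trans IH; exact: prox_iterate_fejer.
exists (`|x 0%N| + B) => k.
have B0 : 0 <= B by rewrite addr_ge0.
elim: k => [|k IH]; first by rewrite lerDl.
have yM : `|y k.+1| <= `|x 0%N| + B.
  by apply: (le_trans (yB _)); rewrite lerDr.
rewrite xS; apply: (le_trans (ler_normD _ _)); rewrite 2!normrZ.
have := weight_itv k; move: (c / s k.+1) => t /andP[t0 t1].
rewrite (gtr0_norm t0) ger0_norm ?subr_ge0//.
have := ler_wpM2l (ltW t0) yM.
have := ler_wpM2l (_ : 0 <= 1 - t) IH; rewrite subr_ge0 => /(_ t1).
by move: (_ + B) => M; lra.
Qed.

(** For [e > 0], the closed convex set where [f <= m + e] contains [x k] for all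
    large [k] by [average_rate], hence also every point of the tail hull. *)
Lemma average_tail_hull_argmin : tail_hull x (fun=> True) `<=` argmin f.
Proof.
move=> v v_hull w; apply: le_trans (u_min w).
apply/lee_addgt0Pr => e e0; rewrite -(fineK (argmin_fin_num f_proper u_min)) -EFinD.
apply: (v_hull [set v | (f v <= (m + e)%:E)%E]).
- apply: (closed_sublevel f_lsc (g := fun=> m + e)) => ?; exact: cvg_cst.
- by apply: (midconvex_sublevel f_convex (g := fun=> m + e)) => *; lra.
have /cvgryPge := sqr_step_cvgy c0 s0 sS.
set K := c ^+ 2 * `|y 0%N - u| ^+ 2 / 2.
move=> /(_ (K / e)) [N _ NP]; exists N.+1 => // -[//|k] /= /ltnW/NP /= sk _.
have := average_rate k; rewrite -/K => /andP[_].
rewrite ler_pdivlMr ?exprn_gt0// => h.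
have x_fin := (average_fin_num_and_le k).1.
rewrite -(fineK x_fin) lee_fin -lerBlDl.
rewrite -(ler_pM2r (_ : 0 < s k.+1 ^+ 2)) ?exprn_gt0//; apply: (le_trans h).
by rewrite mulrC -ler_pdivrMr.
Qed.

(** For the proximal iterates, [2 * dot (y k) (v - w)] is, up to a constant, the
    difference of the squared distances to [w] and to [v], which converge; the
    averages inherit the convergence. *)
Lemma is_cvg_dot_average v w : argmin f v -> argmin f w ->
  cvgn (fun k => dot (x k) (v - w) : R).
Proof.
move=> v_min w_min.
have dist_cvg z : argmin f z -> cvgn (fun k => `|y k - z| ^+ 2).
  move=> z_min; apply: nonincreasing_is_cvgn.
    apply/nonincreasing_seqP => k.
    by rewrite ler_sqr ?nnegrE//; exact: prox_iterate_fejer.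
  by exists 0 => _ [k _ <-]; exact: sqr_ge0.
have y_cvg : cvgn (fun k => dot (y k) (v - w) : R).
  rewrite (_ : (fun k => _) = (fun k => (`|y k - w| ^+ 2 - `|y k - v| ^+ 2
      - `|w| ^+ 2 + `|v| ^+ 2) * 2^-1 : R)); last first.
    apply/funext => k; rewrite !(sqr_normB Hdot) dotDr dotNr; lra.
  apply: is_cvgMl; apply: is_cvgD; last exact: is_cvg_cst.
  apply: is_cvgB; last exact: is_cvg_cst.
  by apply: is_cvgB; exact: dist_cvg.
apply/cvg_ex; exists (limn (fun k => dot (y k) (v - w) : R)).
apply: (cvg_weighted_mean _ (sqr_step_cvgy c0 s0 sS) _ y_cvg) => k.
  rewrite sqr_ge0 ler_sqr ?nnegrE ?(step_ge0 c0 s0 sS)//=.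
  by have := step_incr c0 s0 sS k; move: c0; lra.
rewrite xS dotDl !dotZl (sqr_stepS sS k) [_ + _ - _]addrC addKr.
rewrite mulrDr (mulrA _ (1 - _)) (mulrA _ (c / _)) mulrBr mulr1.
have -> : (s k ^+ 2 + c * s k.+1) * (c / s k.+1) = c * s k.+1.
  rewrite -(sqr_stepS sS k); by field; rewrite gt_eqF.
by rewrite addrK.
Qed.

Lemma average_weakly_cvg : exists2 l, argmin f l & weakly_cvg dot x l.
Proof.
have [M xM] := average_bounded.
exact: (weakly_cvg_tail_hull Hdot xM average_tail_hull_argmin is_cvg_dot_average).
Qed.

End Averaging.

Theorem theorem10 (R : realType) (H : completeNormedModType R)
    (dot : {dot H for idfun}) (Hdot : induces_norm dot)
    (f : H -> \bar R) (f_proper : proper_fun f) (f_convex : econvex f)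
    (f_lsc : lower_semicontinuous f) (S_neq0 : argmin f !=set0)
    (alpha : R) (alpha_gt1 : 1 < alpha)
    (s : nat -> R) (s0 : s 0%N = 0)
    (sS : forall k : nat, s k.+1 =
      (alpha - 1 + Num.sqrt ((alpha - 1) ^+ 2 + 4 * s k ^+ 2)) / 2)
    (x y : nat -> H)
    (yS : forall k : nat, y k.+1 = prox (s k.+1 / (alpha - 1)) f (y k))
    (xS : forall k : nat, x k.+1 =
      (1 - (alpha - 1) / s k.+1) *: x k + ((alpha - 1) / s k.+1) *: y k.+1) :
  [/\ \forall k \near \oo, f (x k) \is a fin_num,
      bigO_at_oo (fun k : nat => (\sum_(0 <= i < k.+1) s i)^-1)
        (fun k : nat => fine (f (x k) - ereal_inf (range f))%E),
      bigO_at_oo (fun k : nat => (\sum_(0 <= i < k.+1) s i)^-1) =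
        bigO_at_oo (fun k : nat => (s k ^+ 2)^-1)
    & bigO_at_oo (fun k : nat => (s k ^+ 2)^-1) =
        bigO_at_oo (fun k : nat => ((k.+1)%:R ^+ 2)^-1)]
  /\ exists2 l : H, argmin f l & weakly_cvg dot x l.
Proof.
have c0 : 0 < alpha - 1 by rewrite subr_gt0.
move: (alpha - 1) c0 sS yS xS => c c0 sS yS xS.
have [u u_min] := S_neq0.
have u_fin := argmin_fin_num f_proper u_min.
have x_fin k := (average_fin_num_and_le
  Hdot f_proper f_convex f_lsc c0 s0 sS yS xS u_min k).1.
have x_rate := average_rate
  Hdot f_proper f_convex f_lsc c0 s0 sS yS xS u_min.
have inf_f : ereal_inf (range f) = f u.
  apply/eqP; rewrite eq_le; apply/andP; split.
    by apply: ereal_inf_lbound; exists u.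
  by apply: le_ereal_inf_tmp => _ [v _ <-]; exact: u_min.
have sum_bigO : bigO_at_oo (fun k => (\sum_(0 <= i < k.+1) s i)^-1) =
    bigO_at_oo (fun k => (s k ^+ 2)^-1).
  apply/seteqP; split.
    apply: (bigO_at_oo_subset c0); apply: nearW => k.
    by rewrite -(sum_step s0 sS) invfM normrM (gtr0_norm (_ : 0 < c^-1))
      ?invr_gt0// mulrA divff ?gt_eqF// mul1r.
  have ci0 : 0 < c^-1 by rewrite invr_gt0.
  apply: (bigO_at_oo_subset ci0); apply: nearW => k.
  by rewrite -(sum_step s0 sS) invfM normrM gtr0_norm.
split; last exact: (average_weakly_cvg
  Hdot f_proper f_convex f_lsc c0 s0 sS yS xS u_min).
split=> //.
- by exists 1%N => // -[//|k] _; exact: x_fin.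
- rewrite sum_bigO; apply/eqO_exP.
  set K := c ^+ 2 * `|y 0%N - u| ^+ 2 / 2 in x_rate.
  have K0 : 0 <= K by rewrite divr_ge0// mulr_ge0 ?sqr_ge0.
  exists (K + 1); first by rewrite ltr_wpDl.
  exists 1%N => // -[//|k] _ /=.
  rewrite inf_f fineB ?x_fin//.
  have /andP[h0 hK] := x_rate k.
  rewrite ger0_norm// ger0_norm ?invr_ge0 ?sqr_ge0//.
  apply: (le_trans hK); rewrite ler_wpM2r ?invr_ge0 ?sqr_ge0//.
  by rewrite lerDl.
have sk_gt0 := stepS_gt0 c0 s0 sS.
have inv_le (a b A : R) : 0 < a -> 0 < b -> b <= A * a -> a^-1 <= A * b^-1.
  by move=> a0 b0 ba; rewrite ler_pdivlMr// mulrC ler_pdivrMr.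
apply/seteqP; split.
- have A0 : 0 < (4 / c) ^+ 2 by rewrite exprn_gt0// divr_gt0.
  apply: (bigO_at_oo_subset A0); exists 1%N => // -[//|k] _ /=.
  rewrite !ger0_norm ?invr_ge0 ?sqr_ge0//.
  apply: inv_le; rewrite ?exprn_gt0// -exprMn ler_sqr ?nnegrE//; last first.
    by rewrite mulr_ge0 ?divr_ge0 ?ltW.
  have /andP[sk _] := step_linear c0 s0 sS k.+1.
  (* [4 * s k.+1 >= 2 * c * k.+1 >= c * k.+2]: [4 / c], twice the inverse of
     the slope [c / 2] of the lower bound on [s], absorbs the shift of the index. *)
  rewrite mulrAC ler_pdivlMr//; have := ler0n R k.
  move: sk; rewrite -(natr1 k.+1) -(natr1 k); move: (k%:R) => X sk X0.
  by have := mulr_ge0 (ltW c0) X0; lra.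
- have A0 : 0 < c ^+ 2 by rewrite exprn_gt0.
  apply: (bigO_at_oo_subset A0); exists 1%N => // -[//|k] _ /=.
  rewrite !ger0_norm ?invr_ge0 ?sqr_ge0//.
  apply: inv_le; rewrite ?exprn_gt0// -exprMn ler_sqr ?nnegrE.
  - have /andP[_ sk] := step_linear c0 s0 sS k.+1.
    by apply: (le_trans sk); rewrite ler_pM2l// ler_nat.
  - exact: ltW.
  - by rewrite mulr_ge0// ltW.
Qed.
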